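(* Let $n\ge5$, $d\ge3$, and let $0\ne f\in\operatorname{Sym}^d(P_n^* )$ be nondegenerate with $S_n$-invariant Jacobian $J(f)$, where $P_n=\mathbb C^n$ is the natural permutation module of $S_n$. Then the canonical decomposition of $f$ has exactly one of the following forms: (i) one block $P_n$; (ii) the two blocks $T$ and $H_n$; (iii) $n$ one-dimensional blocks permuted transitively by $S_n$.
   Context: $S_n$ acts on $P_n=\mathbb C^n$ by permuting coordinates; $P_n=T\oplus H_n$ with $T=\mathbb C(1,\dots,1)$ and $H_n=\{x\in\mathbb C^n:x_1+\cdots+x_n=0\}$. The group acts on forms by $(\sigma\cdot h)(x)=h(\sigma^{-1}x)$. For $v\in P_n$, $D_v$ is directional differentiation; $J(f)=\langle D_vf:v\in P_n\rangle\subseteq\operatorname{Sym}^{d-1}(P_n^* )$ is the Jacobian, $S_n$-invariant if $\sigma\cdot J(f)=J(f)$ for all $\sigma\in S_n$. The form $f$ is nondegenerate if $D_vf=0$ implies $v=0$. Let $\Theta_f$ be the polarization of $f$ (the unique symmetric $d$-linear form with $\Theta_f(v,\dots,v)=f(v)$). The center of $f$ is $$Z(f)=\{X\in\operatorname{End}(P_n):\Theta_f(Xv_1,v_2,v_3,\dots,v_d)=\Theta_f(v_1,Xv_2,v_3,\dots,v_d)\ \text{for all }v_i\in P_n\},$$ a finite-dimensional commutative $\mathbb C$-algebra when $f$ is nondegenerate and $d\ge3$ (Harrison). If $e_1,\dots,e_r$ are its primitive idempotents, the canonical decomposition of $f$ is $P_n=V_1\oplus\cdots\oplus V_r$ with canonical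 blocks $V_i=e_iP_n$. *)

(* Defs.v *)
From HB Require Import structures.
From mathcomp Require Import all_boot all_order all_algebra all_fingroup.
From mathcomp Require Export reals complex mpoly.

Set Implicit Arguments.
Unset Strict Implicit.
Unset Printing Implicit Defensive.

Import GRing.Theory Num.Theory.
Local Open Scope ring_scope.

(* P_n is 'rV[K]_n, the i-th coordinate of x being x 0 i; a form of degree d
   on P_n is a d-homogeneous f : {mpoly K[n]}. *)

Section Forms.
Variables (K : fieldType) (n : nat).
Local Notation P := 'rV[K]_n.
Implicit Types (f g h : {mpoly K[n]}) (x v w : P) (s : 'S_n).

Definition form_val f x : K := f.@[fun i => x 0 i].

Definition dirder v f : {mpoly K[n]} := \sum_(i < n) v 0 i *: f^`M(i).

Definition nondegenerate_form f := forall v, dirder v f = 0 -> v = 0.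

(* s sends the i-th standard basis vector to the (s i)-th one. *)
Definition perm_vec s x : P := \row_i x 0 ((s^-1)%g i).

Lemma msym_form_val s h x :
  form_val (msym s h) x = form_val h (perm_vec (s^-1)%g x).
Proof.
rewrite /form_val; elim/mpolyind: h => [|c m p _ _ IHp].
  by rewrite raddf0 !meval0.
rewrite msymD msymZ !mevalD !mevalZ IHp msymX !mevalX; congr (_ * _ + _).
rewrite (reindex_inj (@perm_inj _ s)) /=; apply: eq_bigr => i _.
by rewrite mnmE permK mxE invgK.
Qed.

Definition jacobian f g :=
  exists (m : nat) (c : 'I_m -> K) (v : 'I_m -> P),
    g = \sum_(j < m) c j *: dirder (v j) f.

Definition jacobian_invariant f :=
  forall s g, (exists2 h, jacobian f h & g = msym s h) <-> jacobian f g.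

Definition perm_lfun s : 'End(P) := linfun (perm_vec s).

Lemma perm_vec_is_linear s : linear (perm_vec s).
Proof. by move=> a x y; apply/rowP => i; rewrite !mxE. Qed.

Lemma perm_lfunE s x : perm_lfun s x = perm_vec s x.
Proof.
pose L := GRing.isLinear.Build _ _ _ _ (perm_vec s) (perm_vec_is_linear s).
pose F : {linear P -> P} := HB.pack (perm_vec s) L.
exact: (lfunE F).
Qed.

Definition Tn : {vspace P} := <[const_mx 1]>%VS.

Definition sum_coord x : K^o := \sum_(i < n) x 0 i.

Definition Hn : {vspace P} := lker (linfun sum_coord).

Lemma sum_coord_is_linear : linear sum_coord.
Proof.
move=> a x y; rewrite /sum_coord [_ *: (\sum_(_ < _) _)]mulr_sumr -big_split.
by apply: eq_bigr => i _; rewrite !mxE.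
Qed.

Lemma memHn x : (x \in Hn) = (\sum_(i < n) x 0 i == 0).
Proof.
pose L := GRing.isLinear.Build _ _ _ _ sum_coord sum_coord_is_linear.
pose F : {linear P -> K^o} := HB.pack sum_coord L.
by rewrite memv_ker; congr (_ == 0); exact: (lfunE F).
Qed.

Section Polarization.
Variable d : nat.
Implicit Types (vs : {ffun 'I_d -> P}) (Theta : {ffun 'I_d -> P} -> K).

Definition upd vs (i : 'I_d) x : {ffun 'I_d -> P} :=
  [ffun k => if k == i then x else vs k].

Definition multilinear_map Theta :=
  forall vs i (a : K) x y,
    Theta (upd vs i (a *: x + y)) = a * Theta (upd vs i x) + Theta (upd vs i y).

Definition symmetric_map Theta :=
  forall vs (s : 'S_d), Theta [ffun k => vs (s k)] = Theta vs.

Definition is_polarization f Theta :=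
  [/\ multilinear_map Theta, symmetric_map Theta
    & forall v, Theta [ffun => v] = form_val f v].

Definition center Theta (X : 'End(P)) :=
  forall (i j : 'I_d), i = 0%N :> nat -> j = 1%N :> nat ->
  forall vs, Theta (upd vs i (X (vs i))) = Theta (upd vs j (X (vs j))).

Definition idempotent_of Theta (e : 'End(P)) :=
  center Theta e /\ (e \o e)%VF = e.

Definition primitive_idempotent Theta (e : 'End(P)) :=
  [/\ idempotent_of Theta e, e <> 0
    & forall a b, idempotent_of Theta a -> idempotent_of Theta b ->
        (a \o b)%VF = 0 -> (b \o a)%VF = 0 -> e = a + b -> a = 0 \/ b = 0].

Definition canonical_decomposition Theta (Vs : seq {vspace P}) :=
  [/\ exists es : seq 'End(P),
        [/\ uniq es, forall e, e \in es <-> primitive_idempotent Theta e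
          & Vs = [seq limg e | e <- es]],
      (\sum_(V <- Vs) V)%VS = fullv
    & directv (\sum_(V <- Vs) V)].

End Polarization.

Definition one_block (Vs : seq {vspace P}) := Vs = [:: fullv].

Definition blocks_Tn_Hn (Vs : seq {vspace P}) := perm_eq Vs [:: Tn; Hn].

Definition permuted_lines (Vs : seq {vspace P}) :=
  [/\ size Vs = n,
      {in Vs, forall V, \dim V = 1%N},
      forall s, {in Vs, forall V, (perm_lfun s @: V)%VS \in Vs}
    & {in Vs &, forall V W, exists s, (perm_lfun s @: V)%VS = W}].

End Forms.

Lemma polarization_exists (K : numFieldType) (n d : nat) (f : {mpoly K[n]}) :
  f \is d.-homog -> exists Theta, is_polarization (d := d) f Theta.
Proof.
pose HP (g : {mpoly K[n]}) := exists Theta, is_polarization (d := d) g Theta.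
have HP0 : HP 0.
  exists (fun=> 0); split=> [vs i a x y|//|v]; first by rewrite mulr0 addr0.
  by rewrite /form_val meval0.
have HPD c g h : HP g -> HP h -> HP (c *: g + h).
  case=> [T1 [m1 s1 d1]] [T2 [m2 s2 d2]].
  exists (fun vs => c * T1 vs + T2 vs); split=> [vs i a x y|vs s|v].
  - by rewrite m1 m2 !mulrDr mulrCA -!addrA; congr (_ + _); rewrite addrCA.
  - by rewrite s1 s2.
  - by rewrite d1 d2 /form_val mevalD mevalZ.
have HPX (m : 'X_{1..n}) : mdeg m = d -> HP 'X_[m].
  move=> dm; pose ts := flatten [seq nseq (m i) i | i <- enum 'I_n].
  have sz : size ts == d.
    rewrite size_flatten /shape -map_comp sumnE big_map big_enum -dm mdegE.
    by apply/eqP; apply: eq_bigr => i _ /=; rewrite size_nseq.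
  pose t := Tuple sz.
  pose pr (s : 'S_d) (vs : {ffun 'I_d -> 'rV[K]_n}) :=
    \prod_k vs (s k) 0 (tnth t k).
  exists (fun vs => (d`!)%:R^-1 * \sum_(s : 'S_d) pr s vs).
  split=> [vs i a x y|vs u|v].
  - rewrite mulrCA -mulrDr; congr (_ * _).
    rewrite mulr_sumr -big_split; apply: eq_bigr => s _ /=; rewrite /pr.
    have E z : \prod_k upd vs i z (s k) 0 (tnth t k) =
      z 0 (tnth t ((s^-1)%g i)) *
      \prod_(k | k != (s^-1)%g i) vs (s k) 0 (tnth t k).
      rewrite (bigD1 ((s^-1)%g i)) //= ffunE permKV eqxx; congr (_ * _).
      apply: eq_bigr => k /negPf nk; rewrite ffunE ifF //.
      by rewrite -[i in LHS](permKV s) (inj_eq perm_inj).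
    by rewrite !E !mxE mulrDl mulrA.
  - congr (_ * _); rewrite [RHS](reindex_inj (mulIg u)) /=.
    apply: eq_bigr => s _; apply: eq_bigr => k _.
    by rewrite ffunE permM.
  - under eq_bigr => s _.
      rewrite /pr; under eq_bigr => k _ do rewrite ffunE.
      over.
    rewrite sumr_const card_Sn.
    rewrite -[X in _ * X]mulr_natl mulKf ?pnatr_eq0 -?lt0n ?fact_gt0 //.
    rewrite /form_val mevalX -(big_tuple _ _ t xpredT (fun i => v 0 i)) /=.
    rewrite /ts big_flatten big_map big_enum; apply: eq_bigr => i _.
    by rewrite big_nseq -iter_mulr_1 ?mulr1.
move=> /dhomogP hf; rewrite -/(HP f) (mpolyE f) big_seq.
elim/big_rec: _ => // m g mf; exact: HPD (HPX _ (hf _ mf)).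
Qed.

Definition exactly_one (A B C : Prop) :=
  [\/ [/\ A, ~ B & ~ C], [/\ ~ A, B & ~ C] | [/\ ~ A, ~ B & C]].

(* Main.v *)
(* For each permutation s, invariance of J(f) gives an endomorphism A with
   Theta(s v_1, ..., s v_d) = Theta(A v_1, v_2, ..., v_d). The left side is
   symmetric, so A lies in the center Z(f), and commutativity of Z(f) then makes
   conjugation by s preserve Z(f). Hence S_n permutes the blocks. If the
   stabilizer of some block has index at least n, then, as there are at most n
   blocks, they are n lines forming a single orbit. Otherwise all stabilizers
   have index less than n, hence contain A_n because A_n is simple of order
   n!/2 > (n-1)!; and the only nonzero A_n-submodules of P_n are T, H_n and
   P_n. *)
Require Import Defs.
From mathcomp Require Import all_boot all_order all_algebra all_fingroup.
From mathcomp Require Import gseries alt ring boolp reals complex mpoly.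

Set Implicit Arguments.
Unset Strict Implicit.
Unset Printing Implicit Defensive.

Import GRing.Theory Num.Theory.
Local Open Scope ring_scope.

(** * Preliminaries on polynomials and exponents *)

Lemma poly_ext (K : numDomainType) (p q : {poly K}) :
  (forall t, p.[t] = q.[t]) -> p = q.
Proof.
move=> pq; apply/eqP; rewrite -subr_eq0; apply/eqP.
(* These integers are distinct in characteristic zero, and one too many to be roots of a nonzero
   polynomial. *)
pose s := [seq i%:R : K | i <- iota 0 (size (p - q))].
apply: (@roots_geq_poly_eq0 _ _ s).
- by apply/allP => x _; rewrite /root hornerD hornerN pq subrr.
- by rewrite map_inj_uniq ?iota_uniq // => i j /eqP; rewrite eqr_nat => /eqP.
- by rewrite size_map size_iota.
Qed.

Lemma mnm_neq0 n (m : 'X_{1..n}) : m != 0%MM -> exists i, m i != 0%N.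
Proof.
move=> m0; apply/existsP; rewrite -negb_forall; apply: contra m0 => /forallP m0.
by apply/eqP/mnmP => i; rewrite mnm0E; apply/eqP.
Qed.

(** * Forms along lines *)

Section DirectionalDerivative.
Variables (K : numFieldType) (n : nat).
Local Notation P := 'rV[K]_n.
Implicit Types (g h : {mpoly K[n]}) (v w : P).

Lemma dirder_sum (I : finType) (c : I -> K) (v : I -> P) g :
  dirder (\sum_i c i *: v i) g = \sum_i c i *: dirder (v i) g.
Proof.
rewrite /dirder; under [RHS]eq_bigr => j _ do rewrite scaler_sumr.
rewrite exchange_big; apply: eq_bigr => i _ /=.
rewrite summxE scaler_suml; apply: eq_bigr => j _.
by rewrite !mxE scalerA.
Qed.

Lemma dirder_delta i g : dirder (delta_mx 0 i) g = g^`M(i).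
Proof.
rewrite /dirder (bigD1 i) //= mxE !eqxx scale1r big1 ?addr0 // => j /negPf ji.
by rewrite mxE eqxx ji scale0r.
Qed.

(** First-order Taylor expansion along a line, phrased with a polynomial in [t] so that derivatives
    are read off as coefficients. *)
Definition line_expansion v w g := exists p : {poly K},
  [/\ forall t, form_val g (w + t *: v) = p.[t],
      p`_0 = form_val g w & p`_1 = form_val (dirder v g) w].

(** The property survives products, by the Leibniz rule, and linear combinations, so it only has to
    be checked on constants and variables. *)
Lemma line_expansionP v w g : line_expansion v w g.
Proof.
have LM g1 g2 : line_expansion v w g1 -> line_expansion v w g2 ->
    line_expansion v w (g1 * g2).
  case=> [p1 [e1 z1 o1]] [p2 [e2 z2 o2]]; exists (p1 * p2); split.
  - by move=> t; rewrite hornerM -e1 -e2 /form_val mevalM.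
  - by rewrite coef0M z1 z2 /form_val mevalM.
  - rewrite coefM !big_ord_recr big_ord0 /= add0r z1 z2 o1 o2.
    rewrite addrC -!mevalM -mevalD; congr meval.
    rewrite /dirder mulr_suml mulr_sumr -big_split; apply: eq_bigr => i _ /=.
    by rewrite mderivM scalerDr scalerAl scalerAr.
have LD c g1 g2 : line_expansion v w g1 -> line_expansion v w g2 ->
    line_expansion v w (c *: g1 + g2).
  case=> [p1 [e1 z1 o1]] [p2 [e2 z2 o2]]; exists (c *: p1 + p2); split.
  - by move=> t; rewrite hornerD hornerZ -e1 -e2 /form_val mevalD mevalZ.
  - by rewrite coefD coefZ z1 z2 /form_val mevalD mevalZ.
  - rewrite coefD coefZ o1 o2 /form_val -mevalZ -mevalD; congr meval.
    rewrite /dirder scaler_sumr -big_split; apply: eq_bigr => i _ /=.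
    by rewrite mderivD mderivZ scalerDr !scalerA mulrC.
have L1 : line_expansion v w 1.
  exists 1; split.
  - by move=> t; rewrite hornerC /form_val meval1.
  - by rewrite coefC eqxx /form_val meval1.
  - rewrite coefC /= /dirder big1 /form_val ?meval0 // => i _.
    by rewrite mderivC scaler0.
have L0 : line_expansion v w 0.
  exists 0; split.
  - by move=> t; rewrite horner0 /form_val meval0.
  - by rewrite coef0 /form_val meval0.
  - rewrite coef0 /= /dirder big1 /form_val ?meval0 // => i _.
    by rewrite mderiv0 scaler0.
have LX i : line_expansion v w 'X_i.
  exists ((w 0 i)%:P + (v 0 i) *: 'X); split.
  - by move=> t; rewrite /form_val mevalXU !mxE hornerD hornerC hornerZ hornerX mulrC.
  - by rewrite coefD coefC coefZ coefX mulr0 addr0 /form_val mevalXU.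
  - rewrite coefD coefC coefZ coefX /= add0r mulr1 /dirder (bigD1 i) //= big1.
      have mnm_subUU : (U_(i) - U_(i) = 0 :> 'X_{1..n})%MM.
        by apply/mnmP => j; rewrite mnmBE mnm0E subnn.
      rewrite mderivX mnm1E eqxx scale1r mnm_subUU mpolyX0 addr0.
      by rewrite /form_val mevalZ meval1 mulr1.
    by move=> j /negPf ji; rewrite mderivX mnm1E eq_sym ji scale0r scaler0.
elim/mpolyind: g => [|c m g _ _]; first exact: L0.
apply: LD; rewrite mpolyXE_id; elim/big_ind: _ => // i _.
by elim: (m i) => [|k IH]; rewrite ?expr0 // exprS; apply: LM.
Qed.

(* A polynomial function that vanishes identically has vanishing partial
   derivatives, which reduces every coefficient to a constant one. *)
Lemma form_val_eq0 g : (forall w, form_val g w = 0) -> g = 0.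
Proof.
move=> g0; apply/mpolyP => m; rewrite mcoeff0.
have [k] := ubnP (mdeg m); elim: k m g g0 => // k IH m g g0 mk.
have [->|m0] := eqVneq m 0%MM.
  (* Evaluation at the origin isolates the constant coefficient. *)
  have := g0 0; rewrite /form_val {1}(mpolyE g) raddf_sum /=.
  have E (m1 : 'X_{1..n}) : (g@_m1 *: 'X_[m1]).@[fun i => (0 : P) 0 i] =
      if m1 == 0%MM then g@_0 else 0.
    rewrite mevalZ mevalX; case: eqP => [->|/eqP m1z].
      by rewrite big1 ?mulr1 // => i _; rewrite mnm0E expr0.
    have [i mi] := mnm_neq0 m1z.
    by rewrite (bigD1 i) //= mxE expr0n (negPf mi) mul0r mulr0.
  rewrite (eq_bigr _ (fun m1 _ => E m1)) -big_mkcond /= => H.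
  have [ing|/memN_msupp_eq0 //] := boolP (0%MM \in msupp g).
  by move: H; rewrite -big_filter filter_pred1_uniq ?msupp_uniq // big_seq1.
have [i mi] := mnm_neq0 m0; rewrite -lep1mP in mi.
(* This coefficient of the derivative is the one of [g] at [m] times the positive integer [m i],
   which is nonzero in characteristic zero. *)
have := IH (m - U_(i))%MM (g^`M(i)).
rewrite mcoeff_mderiv submK // => H.
have /eqP : g@_m *+ ((m - U_(i))%MM i).+1 = 0.
  apply: H => [w|]; last first.
    by rewrite -ltnS; apply: leq_trans mk; rewrite ltnS -{2}(submK mi) mdegD mdeg1 addn1.
  have [p [ep _]] := line_expansionP (delta_mx 0 i) w g.
  rewrite dirder_delta => <-.
  have -> : p = 0 by apply: poly_ext => t; rewrite -ep g0 horner0.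
  by rewrite coef0.
by rewrite mulrn_eq0 /= => /eqP.
Qed.

End DirectionalDerivative.
(** * Multilinear maps *)

Section Multilinear.
Variables (K : numFieldType) (n d : nat).
Local Notation P := 'rV[K]_n.
Implicit Types (vs us : {ffun 'I_d -> P}) (F : {ffun 'I_d -> P} -> K) (i j k : 'I_d).

Lemma updE vs i x k : upd vs i x k = if k == i then x else vs k.
Proof. by rewrite ffunE. Qed.

Lemma upd_id vs i : upd vs i (vs i) = vs.
Proof. by apply/ffunP => k; rewrite updE; case: eqP => [->|]. Qed.

Lemma upd_upd vs i x y : upd (upd vs i x) i y = upd vs i y.
Proof. by apply/ffunP => k; rewrite !updE; case: eqP. Qed.

Lemma updC vs i j x y : i != j -> upd (upd vs i x) j y = upd (upd vs j y) i x.
Proof.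
move=> ij; apply/ffunP => k; rewrite !updE; case: (eqVneq k j) => // ->.
by rewrite eq_sym (negPf ij).
Qed.

Lemma upd_perm vs (s : 'S_d) i x :
  [ffun k => upd vs i x (s k)] = upd [ffun k => vs (s k)] ((s^-1)%g i) x.
Proof.
by apply/ffunP => k; rewrite ffunE !updE ffunE -[k == _](inj_eq (@perm_inj _ s)) permKV.
Qed.

Lemma multilinear_upd0 F vs i : multilinear_map F -> F (upd vs i 0) = 0.
Proof.
move=> mF; have := mF vs i 1 0 0; rewrite scale1r addr0 mul1r.
by move/eqP; rewrite -subr_eq subrr eq_sym => /eqP.
Qed.

(** Linearity in a new slot [k] adds ['X] times the polynomial of the family with [us k] in that
    slot; only the constant term of the latter reaches the coefficient of [t]. *)
Lemma multilinear_expansion F vs us (S : seq 'I_d) :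
    multilinear_map F -> uniq S ->
  exists p : {poly K},
    [/\ forall t, F [ffun i => if i \in S then vs i + t *: us i else vs i] = p.[t],
        p`_0 = F vs & p`_1 = \sum_(i <- S) F (upd vs i (us i))].
Proof.
move=> mF; elim: S vs => [|k S IH] vs /=.
  exists (F vs)%:P; split=> [t||]; rewrite ?hornerC ?coefC ?big_nil //.
  by congr F; apply/ffunP => i; rewrite ffunE.
case/andP=> kS uS; have [p [ep zp op]] := IH vs uS.
have [q [eq zq _]] := IH (upd vs k (us k)) uS.
exists (p + 'X * q); split=> [t||].
- rewrite hornerD hornerM hornerX -ep -eq.
  set G := [ffun i => if i \in S then vs i + t *: us i else vs i].
  transitivity (F (upd G k (t *: us k + vs k))).
    congr F; apply/ffunP => i; rewrite updE !ffunE inE.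
    by case: eqP => [->|] //; rewrite addrC.
  rewrite mF addrC; congr (F _ + _ * F _); apply/ffunP => i.
    by rewrite updE; case: eqP => // ->; rewrite ffunE (negPf kS).
  by rewrite !ffunE; case: (eqVneq i k) => // ->; rewrite (negPf kS).
- by rewrite coefD zp coefXM addr0.
- by rewrite coefD op coefXM /= zq big_cons addrC.
Qed.

Lemma multilinear_sum_eq0 F vs us :
    multilinear_map F -> (forall t : K, F [ffun i => vs i + t *: us i] = 0) ->
  \sum_i F (upd vs i (us i)) = 0.
Proof.
move=> mF F0; have [p [ep _]] := multilinear_expansion vs us mF (enum_uniq 'I_d).
rewrite big_enum /= => <-; suff -> : p = 0 by rewrite coef0.
apply: poly_ext => t; rewrite horner0 -ep -[RHS](F0 t).
by congr F; apply/ffunP => i; rewrite !ffunE mem_enum.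
Qed.

(** Both sides are the coefficient of [t] in f(w + tv); on the polarized side the [d] slots
    contribute equally by symmetry. *)
Lemma polarization_dirder f F i v w : is_polarization f F ->
  F (upd [ffun=> w] i v) *+ d = form_val (dirder v f) w.
Proof.
case=> mF sF dF.
have [p [ep _ op]] :=
  multilinear_expansion [ffun=> w] [ffun=> v] mF (enum_uniq 'I_d).
have [q [eq _ <-]] := line_expansionP v w f.
have -> : q = p.
  apply: poly_ext => t; rewrite -ep -eq -dF.
  by congr F; apply/ffunP => k; rewrite !ffunE mem_enum.
have -> : p`_1 = \sum_(k < d) F (upd [ffun=> w] k v).
  by rewrite op big_enum; apply: eq_bigr => k _; rewrite ffunE.
transitivity (\sum_(k < d) F (upd [ffun=> w] i v)).
  by rewrite sumr_const card_ord.
apply: eq_bigr => k _; rewrite -[RHS](sF _ (tperm i k)) upd_perm tpermV tpermR; congr F.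
by apply/ffunP => j; rewrite !ffunE.
Qed.

(* Peeling: if F vanishes on the families constant from slot k on, the linear
   coefficient along u in these slots shows that it vanishes on the families
   constant from slot k + 1 on. *)
Lemma multilinear_eq0 F (i0 : 'I_d) : i0 = 0%N :> nat ->
    multilinear_map F ->
    (forall vs (s : 'S_d), s i0 = i0 -> F [ffun k => vs (s k)] = F vs) ->
    (forall v w, F (upd [ffun=> w] i0 v) = 0) ->
  forall vs, F vs = 0.
Proof.
move=> i00 mF sF dF.
suff H (k : nat) : (0 < k)%N -> forall vs,
    (forall i j, (k <= i)%N -> (k <= j)%N -> vs i = vs j) -> F vs = 0.
  move=> vs; have d0 : (0 < d)%N by rewrite -i00.
  by apply: (H d d0) => i j; rewrite leqNgt ltn_ord.
have d0 : (0 < d)%N by rewrite (leq_trans _ (ltn_ord i0)).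
have ltd : (d.-1 < d)%N by rewrite prednK.
pose l := Ordinal ltd.
have lel i : (i <= l)%N by rewrite -ltnS prednK.
elim: k => // -[_ _|k IH _] vs cst.
  rewrite -(dF (vs i0) (vs l)); congr F; apply/ffunP => i; rewrite updE ffunE.
  case: eqP => [->//|/eqP ii0]; have i_gt0 : (0 < i)%N.
    by rewrite lt0n; apply: contra ii0 => /eqP i0'; rewrite -val_eqE /= i0' i00.
  by apply: cst => //; apply: leq_trans i_gt0 (lel i).
have [dk|kd] := leqP d k.+1.
  by apply: IH => // i j ki; move: (leq_trans dk ki); rewrite leqNgt ltn_ord.
pose k1 := Ordinal kd.
(* Both [vs0] and [us] are constant from slot [k.+1] on, so induction applies to [vs0 + t us] for
   every [t]. In the coefficient of [t] each of these slots contributes [F vs] by symmetry, the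
   others contribute 0. *)
pose vs0 : {ffun 'I_d -> P} := [ffun i : 'I_d => if (i < k.+1)%N then vs i else vs l].
pose us : {ffun 'I_d -> P} := [ffun i : 'I_d => if (i < k.+1)%N then 0 else vs k1].
have vsE : upd vs0 k1 (vs k1) = vs.
  apply/ffunP => i; rewrite updE ffunE; case: eqP => [->//|/eqP ik].
  case: ltnP => // ki; have {}ki : (k.+1 < i)%N.
    by rewrite ltn_neqAle ki andbT eq_sym; apply: contra ik => ik; rewrite -val_eqE.
  apply: cst => //=; exact: leq_trans ki (lel i).
have E i : F (upd vs0 i (us i)) = if (k < i)%N then F vs else 0.
  rewrite [us i]ffunE; case: ltnP => ik; first exact: multilinear_upd0.
  rewrite -(sF _ (tperm k1 i)); last first.
    by rewrite tpermD // -val_eqE /= i00 //; case: (nat_of_ord i) ik.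
  rewrite upd_perm tpermV tpermR -[in RHS]vsE; congr (F (upd _ _ _)).
  apply/ffunP => j; rewrite !ffunE; case: tpermP => [->|->|//] /=.
    by rewrite ltnn ltnNge ik.
  by rewrite ltnn ltnNge ik.
have : \sum_i F (upd vs0 i (us i)) = 0.
  apply: multilinear_sum_eq0 => // t.
  apply: (IH isT) => i j ki kj; rewrite !ffunE.
  by rewrite ![(_ < k.+1)%N]ltnNge ki kj.
rewrite (eq_bigr _ (fun i _ => E i)) -big_mkcond /=.
rewrite sumr_const => /eqP; rewrite mulrn_eq0 => /orP[|/eqP //].
rewrite -leqn0 leqNgt => /negP[]; apply/card_gt0P; exists k1; exact: leqnn.
Qed.

End Multilinear.
(** * The center of a form *)

Section Center.
Variables (K : numFieldType) (n d : nat) (f : {mpoly K[n]}).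
Variable Theta : {ffun 'I_d -> 'rV[K]_n} -> K.
Hypotheses (d_gt2 : (2 < d)%N) (nd_f : nondegenerate_form f).
Hypothesis pol_f : is_polarization f Theta.
Local Notation P := 'rV[K]_n.
Implicit Types (vs : {ffun 'I_d -> P}) (X Y : 'End(P)) (x y z v w : P) (s : 'S_n).

Let o0 : 'I_d := Ordinal (ltnW (ltnW d_gt2)).
Let o1 : 'I_d := Ordinal (ltnW d_gt2).
Let o2 : 'I_d := Ordinal d_gt2.

Let mTheta : multilinear_map Theta. Proof. by case: pol_f. Qed.
Let sTheta : symmetric_map Theta. Proof. by case: pol_f. Qed.

(** With [w] in all other slots, the hypothesis says, up to the factor [d], that the derivative of
    [f] along [x - y] vanishes at [w]. *)
Lemma polarization_nondegenerate x y :
  (forall vs, Theta (upd vs o0 x) = Theta (upd vs o0 y)) -> x = y.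
Proof.
move=> xy; apply/eqP; rewrite -subr_eq0; apply/eqP/nd_f/form_val_eq0 => w.
rewrite -(polarization_dirder o0 _ _ pol_f) addrC -scaleN1r mTheta xy.
by rewrite mulN1r addNr mul0rn.
Qed.

Lemma center_upd X : center Theta X <->
  (forall vs x y, Theta (upd (upd vs o0 (X x)) o1 y) =
                  Theta (upd (upd vs o0 x) o1 (X y))).
Proof.
split=> [cX vs x y|cX i j i0 j1 vs].
  have := cX o0 o1 erefl erefl (upd (upd vs o0 x) o1 y).
  by rewrite updC // !upd_upd !updE /= -updC.
have -> : i = o0 by apply: val_inj.
have -> : j = o1 by apply: val_inj.
have := cX vs (vs o0) (vs o1).
by rewrite upd_id -[LHS]/(Theta (upd (upd vs o0 _) o1 _)) updC // upd_id.
Qed.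

(** The defining identity relates slots 0 and 1; the transposition of slots 1 and [j] carries it to
    slot [j] and fixes slot 0. *)
Lemma center_slot X j vs : center Theta X ->
  Theta (upd vs o0 (X (vs o0))) = Theta (upd vs j (X (vs j))).
Proof.
move=> cX; have [->//|j0] := eqVneq j o0.
rewrite -[LHS](sTheta _ (tperm o1 j)) upd_perm tpermV tpermD //.
set vs' := [ffun k => vs (tperm o1 j k)].
have -> : vs o0 = vs' o0 by rewrite ffunE tpermD.
rewrite (cX o0 o1 erefl erefl) [vs' o1]ffunE tpermL.
rewrite -[LHS](sTheta _ (tperm o1 j)) upd_perm tpermV tpermL; congr (Theta (upd _ _ _)).
by apply/ffunP => k; rewrite !ffunE tpermK.
Qed.

Lemma center_move X i j vs x y : center Theta X -> i != j ->
  Theta (upd (upd vs i (X x)) j y) = Theta (upd (upd vs i x) j (X y)).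
Proof.
move=> cX ij.
have := center_slot i (upd (upd vs i x) j y) cX.
rewrite (center_slot j (upd (upd vs i x) j y) cX) !updE eqxx (negPf ij) eqxx.
by rewrite upd_upd => ->; rewrite !(updC vs _ _ ij) upd_upd.
Qed.

(* Composites can be reordered because d >= 3 leaves a third slot in which X is
   parked while Y moves from slot 0 to slot 1. *)
Lemma center_comm X Y : center Theta X -> center Theta Y -> (X \o Y = Y \o X)%VF.
Proof.
move=> cX cY; apply/lfunP => x; rewrite !comp_lfunE.
apply: polarization_nondegenerate => vs.
have [o01 o02 o12] : [/\ o0 != o1, o0 != o2 & o1 != o2] by [].
have E z : upd vs o0 z = upd (upd (upd vs o0 z) o1 (vs o1)) o2 (vs o2).
  apply/ffunP => k; rewrite !updE.
  by case: (k =P o2) => [->|_] //; case: (k =P o1) => [->|].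
have M02 Z z1 z2 z3 : center Theta Z ->
    Theta (upd (upd (upd vs o0 (Z z1)) o1 z2) o2 z3) =
    Theta (upd (upd (upd vs o0 z1) o1 z2) o2 (Z z3)).
  by move=> cZ; rewrite 2!(updC vs _ z2 o01); apply: center_move.
have M01 Z z1 z2 z3 : center Theta Z ->
    Theta (upd (upd (upd vs o0 (Z z1)) o1 z2) o2 z3) =
    Theta (upd (upd (upd vs o0 z1) o1 (Z z2)) o2 z3).
  move=> cZ; rewrite 2!(updC (upd vs o0 _) _ z3 o12) 2!(updC vs _ z3 o02).
  exact: center_move.
by rewrite (E (X _)) (E (Y _)) (M02 X) // (M01 Y) // -(M02 X) // -(M01 Y).
Qed.

Lemma center_id : center Theta \1%VF.
Proof. by apply/center_upd => vs x y; rewrite !id_lfunE. Qed.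

(** Moving [X] and then [Y] to the other slot reverses their order; commutativity restores it. *)
Lemma center_comp X Y : center Theta X -> center Theta Y -> center Theta (X \o Y)%VF.
Proof.
move=> cX cY; apply/center_upd => vs x y.
rewrite {2}(center_comm cX cY) !comp_lfunE.
by rewrite !center_move.
Qed.

Lemma center_scale_add a X Y :
  center Theta X -> center Theta Y -> center Theta (a *: X + Y).
Proof.
move=> /center_upd cX /center_upd cY; apply/center_upd => vs x y.
rewrite !lfunE /= !lfunE /= mTheta (updC vs _ _ (isT : o0 != o1)) mTheta.
rewrite !(updC vs _ _ (isT : o1 != o0)).
by rewrite cX cY.
Qed.

Lemma centerB X Y : center Theta X -> center Theta Y -> center Theta (X - Y).
Proof.
by move=> cX cY; rewrite addrC -scaleN1r; apply: center_scale_add.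
Qed.

Lemma perm_vecK s : cancel (perm_vec s) (perm_vec s^-1%g : P -> P).
Proof. by move=> x; apply/rowP => i; rewrite !mxE invgK permK. Qed.

Lemma perm_vecKV s : cancel (perm_vec s^-1%g) (perm_vec s : P -> P).
Proof. by move=> x; have := perm_vecK s^-1%g x; rewrite invgK. Qed.

Hypothesis inv_f : jacobian_invariant f.

(** By invariance each transformed partial derivative is a derivative along some vector [u i]; the
    matrix with rows [u i] then represents [A]. *)
Lemma jacobian_transport s :
  exists A : 'End(P), forall v, msym s (dirder v f) = dirder (A v) f.
Proof.
have [u uP] : exists u : 'I_n -> P, forall i, msym s f^`M(i) = dirder (u i) f.
  apply: (@fin_all_exists _ (fun=> P) (fun i u => msym s f^`M(i) = dirder u f)) => i.
  have /(inv_f s _)[m [c [v ->]]] : exists2 h, jacobian f h & msym s f^`M(i) = msym s h.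
    exists f^`M(i) => //; exists 1%N, (fun=> 1), (fun=> delta_mx 0 i).
    by rewrite big_ord1 dirder_delta scale1r.
  by exists (\sum_j c j *: v j); rewrite dirder_sum.
exists (linfun (mulmxr (\matrix_i u i))) => v; rewrite lfunE /= mulmx_sum_row dirder_sum.
rewrite [dirder v f]/dirder raddf_sum; apply: eq_bigr => i _ /=.
by rewrite msymZ uP rowK.
Qed.

Lemma perm_polarization s : exists2 A, center Theta A &
  forall vs, Theta [ffun k => perm_vec s (vs k)] = Theta (upd vs o0 (A (vs o0))).
Proof.
(* The inverse is taken because [msym s^-1] evaluates a form at [perm_vec s w]. Thus the derivative
   of [f] along [perm_vec s v] at [perm_vec s w] is its derivative along [B (perm_vec s v)] at
   [w]. *)
have [B BP] := jacobian_transport s^-1%g.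
pose A := (B \o perm_lfun K s)%VF.
have AE vs : Theta [ffun k => perm_vec s (vs k)] = Theta (upd vs o0 (A (vs o0))).
  apply/eqP; rewrite -subr_eq0; apply/eqP; move: vs.
  (* The difference is multilinear and symmetric in the slots other than 0, so families equal to [w]
     outside slot 0 suffice; there it is an identity of directional derivatives. *)
  apply: (@multilinear_eq0 _ _ _ _ o0) => // [vs i a x y|vs t t0|v w].
  - have E z : [ffun k => perm_vec s (upd vs i z k)] =
               upd [ffun k => perm_vec s (vs k)] i (perm_vec s z).
      by apply/ffunP => k; rewrite !ffunE; case: eqP.
    rewrite !E perm_vec_is_linear mTheta !updE; case: eqP => [<-|/eqP oi].
      rewrite !upd_upd linearP mTheta; ring.
    by rewrite eq_sym in oi; rewrite !(updC vs _ _ oi) mTheta; ring.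
  - congr (_ - _).
      rewrite -[RHS](sTheta _ t); congr Theta; apply/ffunP => k; by rewrite !ffunE.
    rewrite -[RHS](sTheta _ t) upd_perm ffunE t0; congr (Theta (upd _ _ _)).
    by rewrite -{2}t0 permK.
  - apply/eqP; rewrite subr_eq0 updE eqxx upd_upd.
    have -> : [ffun k => perm_vec s (upd [ffun=> w] o0 v k)] =
              upd [ffun=> perm_vec s w] o0 (perm_vec s v).
      by apply/ffunP => k; rewrite !ffunE; case: eqP.
    have d0 : (0 < d)%N by rewrite (ltn_trans _ d_gt2).
    rewrite -(eqr_pMn2r d0) !(polarization_dirder _ _ _ pol_f).
    by rewrite comp_lfunE perm_lfunE -BP msym_form_val invgK.
(* The permuted form [F] is symmetric in all slots, so exchanging slots 0 and 1 moves [A] from one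
   to the other. *)
exists A => //; apply/center_upd => vs x y.
pose F (us : {ffun 'I_d -> P}) := Theta [ffun k => perm_vec s (us k)].
have F0 us z : F (upd us o0 z) = Theta (upd us o0 (A z)).
  by rewrite /F AE updE eqxx upd_upd.
have Fsym (us : {ffun 'I_d -> P}) (t : 'S_d) : F [ffun k => us (t k)] = F us.
  rewrite /F -[RHS](sTheta _ t); congr Theta; by apply/ffunP => k; rewrite !ffunE.
rewrite (updC vs _ _ (isT : o0 != o1)) -F0.
rewrite -(Fsym _ (tperm o0 o1)) !upd_perm tpermV tpermL tpermR.
rewrite (updC _ _ _ (isT : o0 != o1)) F0.
rewrite -[LHS](sTheta _ (tperm o0 o1)) !upd_perm tpermV tpermL tpermR.
congr (Theta (upd (upd _ _ _) _ _)).
by apply/ffunP => k; rewrite !ffunE tpermK.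
Qed.

(** Pulled back by [s], the identity compares [A (X x')] and [y'] in slots 0 and 1 with [A x'] and
    [X y']: [X] commutes with [A] and can then change slots. *)
Lemma center_conj s X : center Theta X ->
  center Theta (perm_lfun K s \o X \o perm_lfun K s^-1%g)%VF.
Proof.
move=> cX; have [A cA AE] := perm_polarization s.
apply/center_upd => vs x y; rewrite !comp_lfunE !perm_lfunE.
have E z1 z2 : Theta (upd (upd vs o0 (perm_vec s z1)) o1 (perm_vec s z2)) =
    Theta (upd (upd [ffun k => perm_vec s^-1%g (vs k)] o0 (A z1)) o1 z2).
  rewrite [in RHS](updC _ _ _ (isT : o0 != o1)).
  set us := upd _ o1 z2; have := AE (upd us o0 z1); rewrite updE eqxx upd_upd.
  move <-; congr Theta; apply/ffunP => k; rewrite !ffunE; case: eqP => [->|] //.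
  by case: eqP => // _; rewrite perm_vecKV.
rewrite -{2}(perm_vecKV s x) -[in LHS](perm_vecKV s y) !E.
by rewrite -!comp_lfunE (center_comm cA cX) comp_lfunE center_move.
Qed.

End Center.
(** * Primitive idempotents *)

Section PrimitiveIdempotents.
Variables (K : numFieldType) (n d : nat) (f : {mpoly K[n]}).
Variable Theta : {ffun 'I_d -> 'rV[K]_n} -> K.
Hypotheses (d_gt2 : (2 < d)%N) (nd_f : nondegenerate_form f).
Hypothesis pol_f : is_polarization f Theta.
Implicit Types (e a b : 'End('rV[K]_n)).
Local Notation idem := (idempotent_of Theta).
Local Notation prim := (primitive_idempotent Theta).

Lemma idempotent_comm a b : idem a -> idem b -> (a \o b = b \o a)%VF.
Proof. by case=> ca _ [cb _]; apply: (center_comm d_gt2 nd_f pol_f). Qed.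

Lemma idempotent_comp a b : idem a -> idem b -> idem (a \o b)%VF.
Proof.
move=> ia ib; have ab := idempotent_comm ia ib; case: ia ib => ca aa [cb bb].
split; first exact: (center_comp d_gt2 nd_f pol_f).
by rewrite -comp_lfunA [(b \o (a \o b))%VF]comp_lfunA -ab -comp_lfunA bb comp_lfunA aa.
Qed.

Lemma idempotentB e a : idem e -> idem a -> (e \o a)%VF = a -> idem (e - a).
Proof.
move=> ie ia ea; have := idempotent_comm ie ia; rewrite ea => ae.
case: ie ia => ce ee [ca aa]; split; first exact: (centerB d_gt2 pol_f).
by rewrite comp_lfunDl comp_lfunNl !comp_lfunDr !comp_lfunNr ee ea -ae aa subrr subr0.
Qed.

Lemma idempotent_id : idem \1%VF.
Proof. by split; [exact: center_id | rewrite comp_lfun1l]. Qed.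

(** The products of [e] with [a] and with [1 - a] split [e] into orthogonal idempotents of the
    center, so one of them is zero. *)
Lemma primitive_comp e a : prim e -> idem a -> (e \o a)%VF = e \/ (e \o a)%VF = 0.
Proof.
case=> ie e0 pe ia; have iea := idempotent_comp ie ia.
have eea : (e \o (e \o a))%VF = (e \o a)%VF by rewrite comp_lfunA (proj2 ie).
have ib := idempotentB ie iea eea.
have ba : ((e \o a) \o (e - (e \o a)) = 0)%VF.
  rewrite comp_lfunDr comp_lfunNr (proj2 iea) (idempotent_comm iea ie) eea.
  exact: subrr.
have ab : ((e - (e \o a)) \o (e \o a) = 0)%VF by rewrite (idempotent_comm ib iea).
have [||/eqP] := pe _ _ iea ib ba ab; first by rewrite addrC subrK.
  by right.
by rewrite subr_eq0 => /eqP <-; left.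
Qed.

(** A nonzero product would equal both [e] and [a]. *)
Lemma primitive_orthogonal e a : prim e -> prim a -> e <> a -> (e \o a)%VF = 0.
Proof.
move=> pe pa ea; have [ie _ _] := pe; have [ia _ _] := pa.
have [eae|//] := primitive_comp pe ia.
have [aea|ae0] := primitive_comp pa ie; last by rewrite (idempotent_comm ie ia).
by case: ea; rewrite -eae (idempotent_comm ie ia).
Qed.

Lemma primitive_decomposition e : idem e ->
  exists2 es : seq 'End('rV[K]_n), forall a, a \in es -> prim a & e = \sum_(a <- es) a.
Proof.
have [k] := ubnP (\dim (limg e)); elim: k e => // k IH e ek ie.
have [->|/eqP e0] := eqVneq e 0; first by exists [::]; rewrite ?big_nil.
have [split_e|prim_e] := EM (exists a b,
    [/\ idem a, idem b, (a \o b)%VF = 0, (b \o a)%VF = 0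
      & [/\ e = a + b, a != 0 & b != 0]]);
  last first.
  exists [:: e]; last by rewrite big_seq1.
  move=> a; rewrite inE => /eqP ->; split=> // {}a b ia ib ab ba eab.
  have [|a0] := eqVneq a 0; first by left.
  by have [|b0] := eqVneq b 0; [right | case: prim_e; exists a, b].
(* The induction is on the rank: a summand [a] with the same image as [e] would act as the identity
   there, so [a = e] and [b = 0]. *)
have lt_dim a b : idem a -> (b \o a)%VF = 0 -> (a \o b)%VF = 0 -> e = a + b -> b != 0 ->
    (\dim (limg a) < k)%N.
  move=> [_ aa] ba ab eab b0; rewrite -ltnS; apply: leq_trans ek; rewrite ltnS.
  have ea : (e \o a)%VF = a by rewrite eab comp_lfunDl aa ba addr0.
  have sub_ae : (limg a <= limg e)%VS by rewrite -ea limg_comp limgS ?subvf.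
  rewrite ltn_neqAle dimvS // andbT; apply: contra b0 => /eqP dim_ae.
  have lim_ae : limg a = limg e by apply/eqP; rewrite eqEdim sub_ae dim_ae /=.
  have ae : (a \o e)%VF = a by rewrite eab comp_lfunDr aa ab addr0.
  suff : a = e by rewrite eab => /eqP; rewrite addrC -subr_eq subrr eq_sym.
  rewrite -[LHS]ae; apply/lfunP => x; rewrite comp_lfunE.
  have : e x \in limg a by rewrite lim_ae memv_img ?memvf.
  by case/memv_imgP => y _ ->; rewrite -comp_lfunE aa.
have [a [b [ia ib ab ba [eab a0 b0]]]] := split_e.
have [esa pa sa] := IH a (lt_dim a b ia ba ab eab b0) ia.
have [esb pb sb] := IH b (lt_dim b a ib ab ba (etrans eab (addrC a b)) a0) ib.
exists (esa ++ esb); last by rewrite big_cat eab /= -sa -sb.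
by move=> c; rewrite mem_cat => /orP[/pa|/pb].
Qed.

Lemma comp_lfun_suml (es : seq 'End('rV[K]_n)) e :
  (e \o (\sum_(a <- es) a) = \sum_(a <- es) (e \o a))%VF.
Proof.
by elim: es => [|a es IH]; rewrite ?big_nil ?comp_lfun0r // !big_cons comp_lfunDr IH.
Qed.

Lemma primitive_idempotents_sum1 : exists es : seq 'End('rV[K]_n),
  [/\ uniq es, forall e, e \in es <-> prim e & \sum_(e <- es) e = \1%VF].
Proof.
have [es0 pes0 s0] := primitive_decomposition idempotent_id.
pose es := undup es0.
have pes e : e \in es -> prim e by rewrite mem_undup => /pes0.
(* The identity is a sum of members of [es], possibly repeated. This fact shows both that no
   primitive idempotent is missing from [es] and that the sum without repetitions is still the
   identity. *)
have kill e : (forall a, a \in es -> (e \o a)%VF = 0) -> e = 0.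
  move=> ea; rewrite -[LHS]comp_lfun1r s0 comp_lfun_suml big_seq big1 // => a aes0.
  by apply: ea; rewrite mem_undup.
exists es; split; first exact: undup_uniq.
  move=> e; split=> [/pes //|pe]; apply: contrapT => /negP ees.
  have [_ e0 _] := pe; apply: e0; apply: kill => a aes.
  by apply: primitive_orthogonal; [| exact: pes | move=> ea; rewrite ea aes in ees].
apply/eqP; rewrite -subr_eq0; apply/eqP/kill => a aes.
rewrite comp_lfunDl comp_lfunNl comp_lfun1l.
apply/eqP; rewrite subr_eq0; apply/eqP.
have E e : e \in es -> (e \o a = if e == a then a else 0)%VF.
  move=> ees; case: eqP => [->|ea]; first by case: (pes a aes) => -[].
  by apply: primitive_orthogonal => //; apply: pes.
have -> : ((\sum_(e <- es) e) \o a = \sum_(e <- es) (e \o a))%VF.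
  by elim: (es) => [|b bs IH]; rewrite ?big_nil ?comp_lfun0l // !big_cons comp_lfunDl IH.
rewrite big_seq (eq_bigr _ E) -big_seq -big_mkcond -big_filter.
by rewrite filter_pred1_uniq ?undup_uniq // big_seq1.
Qed.

End PrimitiveIdempotents.

(** * Direct sums from orthogonal idempotents *)

Section OrthogonalIdempotents.
Variables (K : fieldType) (V : vectType K) (es : seq 'End(V)).
Hypotheses (uniq_es : uniq es) (sum_es : \sum_(e <- es) e = \1%VF).
Hypothesis idem_es : forall e, e \in es -> (e \o e)%VF = e.
Hypothesis orth_es : forall e a, e \in es -> a \in es -> e <> a -> (e \o a)%VF = 0.

Lemma sum_limg_full : (\sum_(U <- [seq limg e | e <- es]) U)%VS = fullv.
Proof.
apply/eqP; rewrite eqEsubv subvf /=; apply/subvP => x _.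
rewrite -[x]id_lfunE -sum_es sum_lfunE big_map.
elim: (es) => [|e s IH]; first by rewrite !big_nil mem0v.
by rewrite !big_cons memv_add // memv_img ?memvf.
Qed.

(** Each [e] is the identity on its own image and kills the others, so its image meets their sum
    only in zero and dimensions add. *)
Lemma sum_dim_limg : (\sum_(U <- [seq limg e | e <- es]) \dim U)%N = \dim {:V}.
Proof.
transitivity (\dim (\sum_(U <- [seq limg e | e <- es]) U)%VS); last first.
  by rewrite sum_limg_full.
rewrite !big_map.
elim: (es) uniq_es orth_es idem_es => [|e s IH] /=; first by rewrite !big_nil dimv0.
case/andP=> es_e us orth idem; rewrite !big_cons IH //; first last.
- by move=> a sa; apply: idem; rewrite inE sa orbT.
- by move=> a b sa sb; apply: orth; rewrite inE ?sa ?sb orbT.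
rewrite dimv_disjoint_sum //; apply/eqP; rewrite -subv0; apply/subvP => x.
rewrite memv_cap memv0 => /andP[/memv_imgP[y _ ->]] => xs.
have ker_s : (\sum_(a <- s) limg a <= lker e)%VS.
  rewrite big_seq; elim/big_rec: _ => [|a W sa WK]; first exact: sub0v.
  rewrite subv_add WK andbT; apply/subvP => _ /memv_imgP[z _ ->].
  rewrite memv_ker -comp_lfunE orth ?lfunE ?inE ?eqxx ?sa ?orbT //.
  by move=> ea; rewrite ea sa in es_e.
by have := subvP ker_s _ xs; rewrite memv_ker -comp_lfunE idem // mem_head.
Qed.

Lemma limg_orthogonal e a : e \in es -> a \in es -> e <> a ->
  (limg e :&: limg a = 0)%VS.
Proof.
move=> ees aes ea; apply/eqP; rewrite -subv0; apply/subvP => x.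
rewrite memv_cap memv0 => /andP[/memv_imgP[y _ ->] /memv_imgP[z _ eyaz]].
by rewrite -(idem_es ees) comp_lfunE eyaz -comp_lfunE orth_es // lfunE.
Qed.

Lemma directv_limg : directv (\sum_(U <- [seq limg e | e <- es]) U).
Proof. by rewrite directvE /= sum_limg_full sum_dim_limg. Qed.

End OrthogonalIdempotents.
(** * The alternating group *)

Section AltModules.
Variables (K : numFieldType) (n : nat).
Hypothesis n_gt4 : (4 < n)%N.
Local Notation P := 'rV[K]_n.
Implicit Types (U : {vspace P}) (x y : P) (s t : 'S_n) (a b c i j k l m p : 'I_n).

(** The order reverses because a product of permutations applies its left factor first. *)
Lemma perm_lfunM s t : perm_lfun K (s * t)%g = (perm_lfun K t \o perm_lfun K s)%VF.
Proof.
apply/lfunP => x; rewrite comp_lfunE !perm_lfunE.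
by apply/rowP => i; rewrite !mxE invMg permM.
Qed.

Lemma perm_lfun1 : perm_lfun K (1 : 'S_n)%g = \1%VF.
Proof.
apply/lfunP => x; rewrite id_lfunE perm_lfunE.
by apply/rowP => i; rewrite !mxE invg1 perm1.
Qed.

Lemma perm_vec_delta s i : perm_vec s (delta_mx 0 i : P) = delta_mx 0 (s i).
Proof.
apply/rowP => j; rewrite !mxE eqxx /=.
by rewrite -(inj_eq (@perm_inj _ s)) permKV.
Qed.

Lemma ord_outside (r : seq 'I_n) : (size r < n)%N -> exists k, k \notin r.
Proof.
move=> rn; suff /subsetPn[k _ kr] : ~~ ([set: 'I_n] \subset [set x in r]).
  by exists k; rewrite inE in kr.
apply: contraL rn => /subset_leq_card; rewrite cardsT card_ord cardsE -leqNgt.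
by move/leq_trans; apply; apply: card_size.
Qed.

(* The 3-cycle a -> c -> b -> a. *)
Definition cycle3 a b c : 'S_n := (tperm a b * tperm b c)%g.

Lemma cycle3_even a b c : a != b -> b != c -> ~~ odd_perm (cycle3 a b c).
Proof. by move=> ab bc; rewrite odd_mul_tperm odd_tperm ab bc. Qed.

Lemma cycle3L a b c : cycle3 a b c a = c.
Proof. by rewrite permM !tpermL. Qed.

Lemma cycle3R a b c : a != c -> b != c -> cycle3 a b c c = b.
Proof. by move=> ac bc; rewrite permM (tpermD ac bc) tpermR. Qed.

Lemma cycle3M a b c : a != b -> a != c -> cycle3 a b c b = a.
Proof. by move=> ab ac; rewrite permM tpermR tpermD // eq_sym. Qed.

Lemma cycle3D a b c i : a != i -> b != i -> c != i -> cycle3 a b c i = i.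
Proof. by move=> ai bi ci; rewrite permM !tpermD. Qed.

Definition Alt_stable U :=
  forall s, ~~ odd_perm s -> forall x, x \in U -> perm_vec s x \in U.

(** A 3-cycle fixing [i] carries [l] to any other index [m], and the differences of basis vectors so
    obtained span the sum-zero hyperplane. *)
Lemma Alt_stable_delta U i l : Alt_stable U -> i != l ->
  (delta_mx 0 i - delta_mx 0 l : P) \in U -> forall x, x \in Hn K n -> x \in U.
Proof.
move=> sU il ilU.
have H m : (delta_mx 0 m - delta_mx 0 i : P) \in U.
  have [->|mi] := eqVneq m i; first by rewrite subrr mem0v.
  rewrite -memvN opprB; have [->//|ml] := eqVneq m l.
  have [|p] := ord_outside (r := [:: i; l; m]); first by rewrite (leq_trans _ n_gt4).
  rewrite !inE !negb_or => /and3P[pi pl pm].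
  have even_c : ~~ odd_perm (cycle3 l p m) by rewrite cycle3_even // eq_sym.
  suff <- : perm_vec (cycle3 l p m) (delta_mx 0 i - delta_mx 0 l : P) =
            delta_mx 0 i - delta_mx 0 m by apply: sU.
  rewrite -scaleN1r addrC perm_vec_is_linear !perm_vec_delta cycle3L.
  by rewrite cycle3D // 1?eq_sym // scaleN1r addrC.
move=> x; rewrite memHn => /eqP x0.
have -> : x = \sum_m x 0 m *: (delta_mx 0 m - delta_mx 0 i).
  under eq_bigr => m _ do rewrite scalerBr.
  by rewrite sumrB -scaler_suml x0 scale0r subr0 -row_sum_delta.
by apply: memv_suml => m _; rewrite memvZ.
Qed.

(* If x_i != x_j, subtracting from x its image under a 3-cycle moving j to i
   leaves a vector y supported on three points with y_i != 0; a 3-cycle meeting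
   this support in i only then yields a nonzero multiple of e_i - e_l. *)
Lemma Alt_stable_Hn U : Alt_stable U -> ~~ (U <= Tn K n)%VS -> (Hn K n <= U)%VS.
Proof.
move=> sU /subvPn[x xU xT].
have [i [j xij]] : exists i j, x 0 i != x 0 j.
  apply: contrapT => H; case/negP: xT; apply/vlineP.
  exists (x 0 (Ordinal (ltnW (ltnW (ltnW (ltnW n_gt4)))))).
  apply/rowP => i; rewrite !mxE mulr1; apply/eqP; apply: contrapT => /negP xi.
  by apply: H; exists i; eexists; exact: xi.
have ij : i != j by apply: contraNneq xij => ->.
have [|k] := ord_outside (r := [:: i; j]); first by rewrite (leq_trans _ n_gt4).
rewrite !inE !negb_or => /andP[ki kj].
have [|l] := ord_outside (r := [:: i; j; k]); first by rewrite (leq_trans _ n_gt4).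
rewrite !inE !negb_or => /and3P[li lj lk].
(* The fifth index is where n >= 5 is used: two points outside the support of [y] are needed for
   [h]. *)
have [|m] := ord_outside (r := [:: i; j; k; l]); first by rewrite (leq_trans _ n_gt4).
rewrite !inE !negb_or => /and4P[mi mj mk ml].
pose s := cycle3 j k i; pose h := cycle3 i m l.
pose y := x - perm_vec s x.
have permV_eq (t : 'S_n) a b : t a = b -> (t^-1)%g b = a by move=> <-; rewrite permK.
have yU : y \in U.
  by rewrite memvB // sU // cycle3_even // eq_sym.
have yi : y 0 i = x 0 i - x 0 j by rewrite !mxE (permV_eq _ j) // cycle3L.
have y0 p : p != i -> p != j -> p != k -> y 0 p = 0.
  move=> pi pj pk; rewrite !mxE (permV_eq _ p) ?subrr //.
  by rewrite cycle3D // eq_sym.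
have hyU : y - perm_vec h y \in U.
  by rewrite memvB // sU // cycle3_even // eq_sym.
have yE : y - perm_vec h y = (x 0 i - x 0 j) *: (delta_mx 0 i - delta_mx 0 l).
  clearbody y; apply/rowP => p; rewrite !mxE !eqxx /=.
  have [->|pi] := eqVneq p i.
    rewrite (permV_eq _ m); last by rewrite cycle3M // eq_sym.
    by rewrite (y0 m) // yi eq_sym (negPf li) !subr0 mulr1.
  have [->|pl] := eqVneq p l.
    rewrite (permV_eq _ i); last by rewrite cycle3L.
    by rewrite (y0 l) // yi ?(negPf li) !sub0r mulrN1.
  have [->|pm] := eqVneq p m.
    rewrite (permV_eq _ l); last by rewrite cycle3R // eq_sym.
    by rewrite (y0 m) // (y0 l) // ?(negPf mi) ?(negPf ml) !subrr mulr0.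
  rewrite (permV_eq _ p); last by rewrite cycle3D // eq_sym.
  by rewrite ?(negPf pi) ?(negPf pl) !subrr mulr0.
have ilU : (delta_mx 0 i - delta_mx 0 l : P) \in U.
  by move: hyU; rewrite yE rpredZeq subr_eq0 (negPf xij).
apply/subvP => z; apply: (@Alt_stable_delta U i l) => //; by rewrite eq_sym.
Qed.

Lemma Alt_stable_cases U : Alt_stable U -> U <> 0%VS ->
  [\/ U = Tn K n, U = Hn K n | U = fullv].
Proof.
move=> sU U0; have [UT|UT] := boolP (U <= Tn K n)%VS.
  constructor 1; apply/eqP; rewrite eqEdim UT (leq_trans (_ : _ <= 1)%N) //.
    by rewrite dim_vline leq_b1.
  by rewrite lt0n dimv_eq0; apply/eqP.
have HU := Alt_stable_Hn sU UT.
have [UH|/subvPn[u uU uH]] := boolP (U <= Hn K n)%VS.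
  by constructor 2; apply/eqP; rewrite eqEsubv UH.
constructor 3; apply/eqP; rewrite eqEsubv subvf /=; apply/subvP => x _.
(* This scalar gives [x - c *: u] coordinate sum zero, so it lies in [Hn], hence in [U]. *)
rewrite memHn in uH; pose c := (\sum_i x 0 i) / (\sum_i u 0 i).
rewrite -[x](subrK (c *: u)) memvD ?memvZ ?uU ?orbT // (subvP HU) // memHn.
under eq_bigr => i _ do rewrite !mxE.
by rewrite sumrB -mulr_sumr divfK // subrr.
Qed.

End AltModules.

(* Otherwise A_n would act faithfully on the cosets of G. *)
Lemma Alt_sub_small_index n (G : {group 'S_n}) : (4 < n)%N ->
  (#|[set: 'S_n] : G|%g < n)%N -> ('Alt_('I_n) \subset G)%g.
Proof.
move=> n_gt4 ixG; set A := ('Alt_('I_n))%G.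
have /simpleP[_ nA] : simple A by apply: simple_Alt5; rewrite card_ord.
set R := rcosets G [set: 'S_n].
have actR : [acts [set: 'S_n], on R | 'Rs] := actsRs_rcosets G [set: 'S_n].
have sAR : A \subset 'N(R | 'Rs)%g by apply: subset_trans (subsetT _) actR.
pose C := ('C_A(R | 'Rs))%G.
have nC : (C <| A)%g by apply: normalGI sAR (astab_normal _ _).
case: (nA C nC) => /= [C1|CA].
  have faithA : [faithful A, on R | 'Rs]%g by rewrite /faithful C1.
  have /isom_card cA := faithful_isom sAR faithA.
  (* A faithful action on at most n - 1 cosets would give n!/2 <= (n-1)!, that is n <= 2. *)
  suff : (n <= 2)%N by rewrite leqNgt (ltnW (ltnW n_gt4)).
  have Rn : (#|R| <= n.-1)%N by rewrite -ltnS (ltn_predK n_gt4).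
  have cR : (#|A| <= (n.-1)`!)%N.
    rewrite cA; apply: leq_trans (leq_fact Rn); rewrite -card_perm.
    apply/subset_leq_card/subsetP => _ /morphimP[a _ _ ->].
    apply/subsetP => X; apply: contraR => XR.
    by rewrite actpermE /= /actby (negPf XR).
  have n_gt0 : (0 < n)%N by apply: leq_trans n_gt4.
  have := card_Alt (T := 'I_n); rewrite card_ord => /(_ (ltn_trans _ n_gt4)) cAn.
  rewrite -(@leq_pmul2r (n.-1)`!) ?fact_gt0 //.
  rewrite -[in X in (X * _ <= _)%N](prednK n_gt0) -factS prednK // -cAn //.
  by rewrite leq_mul2l.
(* In the remaining case [A] acts trivially; in particular it fixes the coset [G], whose stabilizer
   is [G] itself. *)
have GR : gval G \in R by apply/rcosetsP; exists 1%g; rewrite ?inE ?mulg1.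
by rewrite -CA -(astab1Rs G) subIset // astabS ?orbT // sub1set.
Qed.
(** * Blocks *)

Section BlockSystem.
Variables (K : numFieldType) (n : nat) (Vs : seq {vspace 'rV[K]_n}).
Implicit Types (V W : {vspace 'rV[K]_n}) (s t : 'S_n).

Lemma perm_lfun_imgM s t V :
  (perm_lfun K (s * t)%g @: V = perm_lfun K t @: (perm_lfun K s @: V))%VS.
Proof. by rewrite perm_lfunM limg_comp. Qed.

Lemma perm_lfun_img1 V : (perm_lfun K 1%g @: V = V)%VS.
Proof. by rewrite perm_lfun1 lim1g. Qed.

Definition perm_stab V : {set 'S_n} := [set s | (perm_lfun K s @: V)%VS == V].

Lemma perm_stab_group_set V : group_set (perm_stab V).
Proof.
apply/group_setP; split=> [|s t]; first by rewrite inE perm_lfun_img1.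
by rewrite !inE perm_lfun_imgM => /eqP -> /eqP ->.
Qed.

Canonical perm_stab_group V := Group (perm_stab_group_set V).

(** Right cosets of the stabilizer parametrize the orbit, since the left factor of a product acts
    first. *)
Lemma perm_orbit V : exists Ws : seq {vspace 'rV[K]_n},
  [/\ uniq Ws, size Ws = #|[set: 'S_n] : perm_stab V|%g
    & forall W, W \in Ws -> exists s, W = (perm_lfun K s @: V)%VS].
Proof.
exists [seq (perm_lfun K (repr C) @: V)%VS
       | C <- enum (rcosets (perm_stab V) [set: 'S_n])].
split; last by move=> W /mapP[C _ ->]; exists (repr C).
  rewrite map_inj_in_uniq ?enum_uniq // => C D.
  rewrite !mem_enum => /rcosetsP[x _ ->] /rcosetsP[y _ ->].
  move=> xy; rewrite -[LHS]rcoset_repr -[RHS]rcoset_repr; apply/rcoset_eqP.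
  by rewrite mem_rcoset inE perm_lfun_imgM xy -perm_lfun_imgM mulgV perm_lfun_img1.
by rewrite size_map -cardE.
Qed.

Hypotheses (n_gt4 : (4 < n)%N) (uniq_Vs : uniq Vs).
Hypothesis Vs_neq0 : forall V, V \in Vs -> V <> 0%VS.
Hypothesis Vs_disjoint : {in Vs &, forall V W, V <> W -> (V :&: W = 0)%VS}.
Hypothesis sum_Vs : (\sum_(V <- Vs) V)%VS = fullv.
Hypothesis sum_dim_Vs : (\sum_(V <- Vs) \dim V)%N = n.
Hypothesis perm_Vs : forall s, {in Vs, forall V, (perm_lfun K s @: V)%VS \in Vs}.

Lemma dim_block_gt0 V : V \in Vs -> (0 < \dim V)%N.
Proof. by move/Vs_neq0/eqP; rewrite lt0n dimv_eq0. Qed.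

Lemma size_blocks : (size Vs <= n)%N.
Proof.
rewrite -[leqRHS]sum_dim_Vs -sum1_size big_seq [leqRHS]big_seq.
exact: leq_sum dim_block_gt0.
Qed.

Lemma dim_block1 V : size Vs = n -> V \in Vs -> \dim V = 1%N.
Proof.
move=> sz VVs; have : (\sum_(W <- Vs) \dim W <= \sum_(W <- Vs) 1)%N.
  by rewrite sum_dim_Vs sum1_size sz.
rewrite !(big_rem V VVs) /= => H; apply/eqP; rewrite eqn_leq dim_block_gt0 // andbT.
rewrite -(leq_add2r (\sum_(W <- rem V Vs) 1)); apply: leq_trans H.
rewrite leq_add2l big_seq [leqRHS]big_seq; apply: leq_sum => W /mem_rem.
exact: dim_block_gt0.
Qed.

(** The orbit supplies at least [n] distinct blocks, and positive dimensions adding up to [n] allow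
    no more; so the orbit is everything and every dimension is 1. *)
Lemma orbit_permuted_lines V : V \in Vs -> (n <= #|[set: 'S_n] : perm_stab V|%g)%N ->
  permuted_lines Vs.
Proof.
move=> VVs leni; have [Ws [uW sW WV]] := perm_orbit V.
have WsVs : {subset Ws <= Vs} by move=> W /WV[s ->]; apply: perm_Vs.
have szVW : (size Vs <= size Ws)%N by rewrite sW (leq_trans size_blocks).
have [eqs memVW] := uniq_min_size uW WsVs szVW.
have szVs : size Vs = n.
  by apply/eqP; rewrite eqn_leq size_blocks /= -eqs sW.
split=> // [W|W X]; first exact: dim_block1.
rewrite -!memVW => /WV[s ->] /WV[t ->]; exists (s^-1 * t)%g.
by rewrite -perm_lfun_imgM mulgA mulgV mul1g.
Qed.

Lemma small_orbit_Alt_stable V :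
  (#|[set: 'S_n] : perm_stab V|%g < n)%N -> Alt_stable V.
Proof.
move=> /(Alt_sub_small_index n_gt4)/subsetP stabV s even_s x xV.
have : s \in perm_stab V by apply: stabV; rewrite Alt_even.
by rewrite inE -perm_lfunE => /eqP <-; rewrite memv_img.
Qed.

Lemma Tn_neq_Hn : Tn K n <> Hn K n.
Proof.
move=> TH; have : (const_mx 1 : 'rV[K]_n) \in Hn K n by rewrite -TH memv_line.
rewrite memHn; under eq_bigr => i _ do rewrite mxE.
by rewrite sumr_const card_ord pnatr_eq0; case: (n) n_gt4.
Qed.

Lemma Tn_neqfull : Tn K n <> fullv.
Proof.
move=> Tf; have := dim_vline (const_mx 1 : 'rV[K]_n).
rewrite -/(Tn K n) Tf dimvf /dim /= mul1n => n1.
by move: n_gt4; rewrite n1; case: (_ != _).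
Qed.

Lemma Hn_neqfull : Hn K n <> fullv.
Proof.
move=> Hf; have : (const_mx 1 : 'rV[K]_n) \in Hn K n by rewrite Hf memvf.
rewrite memHn; under eq_bigr => i _ do rewrite mxE.
by rewrite sumr_const card_ord pnatr_eq0; case: (n) n_gt4.
Qed.

Lemma block_trichotomy : exactly_one (one_block Vs) (blocks_Tn_Hn Vs) (permuted_lines Vs).
Proof.
(* The cases exclude each other by the number of blocks: 1, 2 and n >= 5. *)
have excl : [/\ one_block Vs -> size Vs = 1%N, blocks_Tn_Hn Vs -> size Vs = 2
    & permuted_lines Vs -> size Vs = n].
  by split=> [->|/perm_size|[]].
have [sz1 sz2 szn] := excl.
suff : [\/ one_block Vs, blocks_Tn_Hn Vs | permuted_lines Vs].
  case=> [H1|H2|H3].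
  - constructor 1; split=> // [/sz2|/szn]; rewrite sz1 // => n1.
    by move: n_gt4; rewrite -n1.
  - constructor 2; split=> // [/sz1|/szn]; rewrite sz2 // => n2.
    by move: n_gt4; rewrite -n2.
  - constructor 3; split=> // [/sz1|/sz2]; rewrite szn // => n3.
      by move: n_gt4; rewrite n3.
    by move: n_gt4; rewrite n3.
have [[V VVs ixV]|small] := EM (exists2 V, V \in Vs &
    (n <= #|[set: 'S_n] : perm_stab V|%g)%N).
  by constructor 3; apply: orbit_permuted_lines ixV.
have cases V : V \in Vs -> [\/ V = Tn K n, V = Hn K n | V = fullv].
  move=> VVs; apply: Alt_stable_cases => //; last exact: Vs_neq0.
  apply: small_orbit_Alt_stable; rewrite ltnNge; apply/negP => ixV.
  by apply: small; exists V.
(* The whole space meets every nonzero block, so as a block it is the only one. *)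
have [fVs|fVs] := boolP (fullv \in Vs).
  constructor 1; rewrite /one_block.
  apply: perm_small_eq => //; apply: uniq_perm => // V; rewrite inE.
  apply/idP/eqP => [VVs|->//]; apply: contrapT => Vf.
  by apply: (Vs_neq0 VVs); rewrite -(Vs_disjoint VVs fVs Vf) capvf.
(* Since the blocks span, they cannot all lie in [Hn], nor all in [Tn]; hence both spaces must
   occur. *)
have sub_le U : (forall V, V \in Vs -> (V <= U)%VS) -> U = fullv.
  move=> VU; apply/eqP; rewrite eqEsubv subvf /= -sum_Vs big_seq.
  elim/big_rec: _ => [|V W VVs WU]; first exact: sub0v.
  by rewrite subv_add VU.
have TVs : Tn K n \in Vs.
  apply: contrapT => /negP TVs; apply: Hn_neqfull; apply: sub_le => V VVs.
  case: (cases V VVs) => E; [|by rewrite E subvv|].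
    by rewrite -E VVs in TVs.
  by rewrite -E VVs in fVs.
have HVs : Hn K n \in Vs.
  apply: contrapT => /negP HVs; apply: Tn_neqfull; apply: sub_le => V VVs.
  case: (cases V VVs) => E; [by rewrite E subvv| |].
    by rewrite -E VVs in HVs.
  by rewrite -E VVs in fVs.
constructor 2; apply: uniq_perm => //=.
  by rewrite inE andbT; apply/eqP; apply: Tn_neq_Hn.
move=> V; rewrite !inE; apply/idP/orP => [VVs|[/eqP ->|/eqP ->]//].
case: (cases V VVs) => [->|->|Vf]; [by left | by right |].
by rewrite -Vf VVs in fVs.
Qed.

End BlockSystem.

(** * The symmetric group acting on the canonical blocks *)

Section CanonicalBlocks.
Variables (K : numFieldType) (n d : nat) (f : {mpoly K[n]}).
Variable Theta : {ffun 'I_d -> 'rV[K]_n} -> K.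
Hypotheses (d_gt2 : (2 < d)%N) (nd_f : nondegenerate_form f).
Hypotheses (inv_f : jacobian_invariant f) (pol_f : is_polarization f Theta).
Implicit Types (e a b : 'End('rV[K]_n)) (s : 'S_n).

Definition perm_conj s e := (perm_lfun K s \o e \o perm_lfun K s^-1%g)%VF.

Lemma perm_conjE s e x : perm_conj s e x = perm_vec s (e (perm_vec s^-1%g x)).
Proof. by rewrite !comp_lfunE !perm_lfunE. Qed.

Lemma perm_conjK s : cancel (perm_conj s) (perm_conj s^-1%g).
Proof. by move=> e; apply/lfunP => x; rewrite !perm_conjE invgK !perm_vecK. Qed.

Lemma perm_conjM s a b : perm_conj s (a \o b)%VF = (perm_conj s a \o perm_conj s b)%VF.
Proof. by apply/lfunP => x; rewrite comp_lfunE !perm_conjE comp_lfunE perm_vecK. Qed.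

Lemma perm_conjD s a b : perm_conj s (a + b) = perm_conj s a + perm_conj s b.
Proof. by rewrite /perm_conj comp_lfunDr comp_lfunDl. Qed.

Lemma perm_conj0 s : perm_conj s 0 = 0.
Proof. by rewrite /perm_conj comp_lfun0r comp_lfun0l. Qed.

Lemma idempotent_conj s e : idempotent_of Theta e -> idempotent_of Theta (perm_conj s e).
Proof.
case=> ce ee; split; first exact: (center_conj d_gt2 nd_f pol_f inv_f).
by rewrite -perm_conjM ee.
Qed.

(** Conjugation by the inverse of [s] pulls a splitting of the conjugate back to a splitting of
    [e]. *)
Lemma primitive_conj s e :
  primitive_idempotent Theta e -> primitive_idempotent Theta (perm_conj s e).
Proof.
case=> ie e0 pe; split; first exact: idempotent_conj.
  by move=> ce0; apply: e0; rewrite -(perm_conjK s e) ce0 perm_conj0.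
move=> a b ia ib ab ba eab.
have [||||| |] := pe (perm_conj s^-1%g a) (perm_conj s^-1%g b).
- exact: idempotent_conj.
- exact: idempotent_conj.
- by rewrite -perm_conjM ab perm_conj0.
- by rewrite -perm_conjM ba perm_conj0.
- by rewrite -perm_conjD -eab perm_conjK.
- by move=> a0; left; rewrite -(perm_conjK s^-1%g a) a0 perm_conj0.
- by move=> b0; right; rewrite -(perm_conjK s^-1%g b) b0 perm_conj0.
Qed.

Lemma limg_perm_conj s e : limg (perm_conj s e) = (perm_lfun K s @: limg e)%VS.
Proof.
rewrite /perm_conj !limg_comp; congr (_ @: (_ @: _))%VS.
apply/eqP; rewrite eqEsubv subvf; apply/subvP => x _; apply/memv_imgP.
by exists (perm_vec s x); rewrite ?memvf // perm_lfunE perm_vecK.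
Qed.

Lemma canonical_blocks : (4 < n)%N -> exists2 Vs : seq {vspace 'rV[K]_n},
  canonical_decomposition Theta Vs
  & exactly_one (one_block Vs) (blocks_Tn_Hn Vs) (permuted_lines Vs).
Proof.
move=> n_gt4; have [es [ues pes es1]] := primitive_idempotents_sum1 d_gt2 nd_f pol_f.
have ides e : e \in es -> (e \o e)%VF = e by move=> /pes[[]].
have orth e a : e \in es -> a \in es -> e <> a -> (e \o a)%VF = 0.
  by move=> /pes pe /pes pa; apply: (primitive_orthogonal d_gt2 nd_f pol_f).
have limg_neq0 e : e \in es -> limg e <> 0%VS.
  move=> ees le0; have [_ + _] := (pes e).1 ees; apply; apply/lfunP => x.
  rewrite lfunE /=; apply/eqP; rewrite -memv0 -le0 memv_img //.
  exact: memvf.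
have disj := limg_orthogonal ides orth.
exists [seq limg e | e <- es].
  split; first by exists es.
    exact: sum_limg_full.
  exact: (directv_limg ues es1 ides orth).
apply: block_trichotomy => //.
(* Distinct idempotents have images meeting in zero, so equal images would both be zero. *)
- rewrite map_inj_in_uniq // => e a ees aes ea; apply: contrapT => nea.
  by apply: (limg_neq0 e ees); rewrite -(disj e a ees aes nea) -ea capvv.
- by move=> V /mapP[e ees ->]; apply: limg_neq0.
- move=> V W /mapP[e ees ->] /mapP[a aes ->] nea.
  by apply: disj => // ea; rewrite ea in nea.
- exact: sum_limg_full.
- by rewrite (sum_dim_limg ues es1 ides orth) dimvf /dim /= mul1n.
- move=> s V /mapP[e ees ->]; apply/mapP; exists (perm_conj s e).
    exact/pes/primitive_conj/pes.
  by rewrite limg_perm_conj.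
Qed.

End CanonicalBlocks.

Local Close Scope ring_scope.

Theorem lemma4p5 (R : realType) (n d : nat) (f : {mpoly R[i][n]})
  (Theta : {ffun 'I_d -> 'rV[R[i]]_n} -> R[i]) :
  5 <= n -> 3 <= d ->
  f \is d.-homog -> f <> 0%R -> nondegenerate_form f -> jacobian_invariant f ->
  is_polarization f Theta ->
  exists2 Vs : seq {vspace 'rV[R[i]]_n}, canonical_decomposition Theta Vs
    & exactly_one (one_block Vs) (blocks_Tn_Hn Vs) (permuted_lines Vs).
Proof.
by move=> n_gt4 d_gt2 _ _ nd_f inv_f pol_f; apply: (canonical_blocks d_gt2 nd_f).
Qed.
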